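(* Let $0\le a\le b$, let $F$ be a CDF on $[0,\infty)$ with a density $f$ supported on $[0,a]$, and let $g(p)=1/b$ for $p\in[0,b]$ (and $0$ elsewhere) be the density of the historical price distribution. Let $R(p)=p(1-F(p))$ and let $p^*\in\arg\max_{p\ge 0}\ p\int_p^{\infty} g(x)(1-F(x))\,dx$. Assume: (i) $p^*$ is the only solution $p\in[0,a]$ of $p(1-F(p))=\int_p^a(1-F(x))\,dx$ such that $p\int_p^a(1-F(x))\,dx>0$; (ii) $R$ is unimodal on $[0,a]$ and has a unique maximizer $\hat p$. Then $$\frac{R(p^* )}{R(\hat p)}\ \ge\ \min\left\{\frac{\hat p}{p^*},\ \frac12\right\}.$$ Moreover, the bound is asymptotically tight in the following sense: (1) for every $\epsilon>0$ there exist $0\le a\le b$ and a CDF $F$ on $[0,\infty)$ with a density supported on $[0,a]$ such that, with $g(p)=1/b$ on $[0,b]$ (and $0$ elsewhere), $R(p)=p(1-F(p))$ and $p^*\in\arg\max_{p\ge 0}\ p\int_p^{\infty} g(x)(1-F(x))\,dx$, the price $p^*$ is the only solution $p\in[0,a]$ of $p(1-F(p))=\int_p^a(1-F(x))\,dx$ such that $p\int_p^a(1-F(x))\,dx>0$, the function $R$ is unimodal on $[0,a]$ with a unique maximizer $\hat p$, and $R(p^* )/R(\hat p)\le \tfrac12+\epsilon$; (2) for every $0<x_1<x_2<1/e$ and every $\epsilon>0$ there exist $0\le a\le b$ and a CDF $F$ on $[0,\infty)$ with a density supported on $[0,a]$ such that, with $g(p)=1/b$ on $[0,b]$ (and $0$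 elsewhere), $R(p)=p(1-F(p))$ and $p^*\in\arg\max_{p\ge 0}\ p\int_p^{\infty} g(x)(1-F(x))\,dx$, the price $p^*$ is the only solution $p\in[0,a]$ of $p(1-F(p))=\int_p^a(1-F(x))\,dx$ such that $p\int_p^a(1-F(x))\,dx>0$, the function $R$ is unimodal on $[0,a]$ with a unique maximizer $\hat p$, and $\hat p=x_1$, $|p^*-x_2|<\epsilon$, and $R(p^* )/R(\hat p)\le \hat p^{\,1-\epsilon}/(p^* )^{1-\epsilon}$.
   Context: $F$ is the CDF of a random customer's valuation of a single product; $R(p)=p(1-F(p))$ is the expected revenue at price $p$. ''$f$ supported on $[0,a]$'' means $f$ vanishes outside $[0,a]$. $R$ is called unimodal on $[0,a]$ if it is nondecreasing up to a maximizer and nonincreasing after it. $p^*$ is the (asymptotic) model-free optimal price and $\hat p$ the model-based optimal price. *)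

(* Defs.v *)
From HB Require Import structures.
From mathcomp Require Import all_boot all_order all_algebra.
From mathcomp Require Import all_classical all_reals all_analysis.
Set Implicit Arguments.
Unset Strict Implicit.
Unset Printing Implicit Defensive.
Import Order.TTheory GRing.Theory Num.Theory.
Import numFieldNormedType.Exports.

Local Open Scope classical_set_scope.
Local Open Scope ring_scope.

Section pricing.
Context {R : realType}.
Local Notation mu := (@lebesgue_measure R).
Implicit Types (a b p : R) (D : set R) (h f F : R -> R).

Definition argmax D h : set R :=
  [set p | D p /\ forall q, D q -> h q <= h p].

(* CDFs themselves are bundled as [cumulativeBounded 0 1]: nondecreasing,
   right-continuous, with limits 0 at -oo and 1 at +oo.  In particular the
   last clause forces the total mass of [f] to be 1. *)
Definition is_density F f : Prop :=
  [/\ measurable_fun setT f,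
      forall x, 0 <= f x &
      forall x, (F x)%:E = (\int[mu]_(t in `]-oo, x]) (f t)%:E)%E].

Definition supported_on a b f : Prop :=
  forall x, x \notin `[a, b] -> f x = 0.

Definition revenue F p : R := p * (1 - F p).

Definition modelfree_objective (g F : R -> R) p : R :=
  p * \int[mu]_(x in `[p, +oo[) (g x * (1 - F x)).

Definition tail_integral a F p : R := \int[mu]_(x in `[p, a]) (1 - F x).

Definition stationary_prices a F : set R :=
  [set p | [/\ p \in `[0, a],
               p * (1 - F p) = tail_integral a F p &
               0 < p * tail_integral a F p]].

Definition unimodal_on a b h : Prop :=
  exists m, [/\ argmax `[a, b] h m,
    {in `[a, m] &, nondecreasing_fun h} &
    {in `[m, b] &, nonincreasing_fun h}].

(* [uniform_pdf 0 b] is 1/b on [0, b] and 0 elsewhere. *)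
Definition pricing_instance a b F f (pstar phat : R) : Prop :=
  [/\ 0 <= a <= b,
      (forall x, x < 0 -> F x = 0) /\ is_density F f,
      supported_on 0 a f &
      argmax `[0, +oo[ (modelfree_objective (uniform_pdf 0 b) F) pstar] /\
  [/\ stationary_prices a F = [set pstar],
      unimodal_on 0 a (revenue F) &
      argmax `[0, a] (revenue F) = [set phat]].

End pricing.

(* Main.v *)
Require Import Defs.
From HB Require Import structures.
From mathcomp Require Import all_boot all_order all_algebra.
From mathcomp Require Import all_classical all_reals all_analysis.
From mathcomp Require Import measurable_realfun ring lra.
Set Implicit Arguments.
Unset Strict Implicit.
Unset Printing Implicit Defensive.
Import Order.TTheory GRing.Theory Num.Theory.
Import numFieldNormedType.Exports.
Local Open Scope classical_set_scope.
Local Open Scope ring_scope.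

(** Write S = 1 - F for the survival function, T(p) for the integral of S over
    [p, a], and R(p) = p S(p). Since F = 1 beyond a and the price density is
    constant on [0, b], the model-free objective is p T(p) up to the factor
    1/b, and its derivative is T(p) - p S(p) = T(p) - R(p). So the stationary
    price pstar satisfies T(pstar) = R(pstar), and the whole argument compares
    T with R.

    Lower bound. If pstar <= phat, monotonicity of S gives T(pstar) >= (phat -
    pstar) S(phat) and R(pstar) >= pstar S(phat); as both left-hand sides
    equal R(pstar), adding them gives 2 R(pstar) >= R(phat)
    ([half_revenue_le]). If phat < pstar, then T(phat) >= R(phat): T - R is
    continuous and positive at 0, so a negative value before pstar would
    create a second stationary price ([revenue_le_tail_below]). Optimality of
    pstar then yields pstar R(pstar) = pstar T(pstar) >= phat T(phat) >= phat
    R(phat).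

    Tightness. One two-piece family serves both claims: no valuation lies
    below c, so S = 1 and R(p) = p on [0, c], and on [c, a] the survival
    function is chosen so that the objective is a multiple of the cubic (a -
    p)^2 (p + beta). For beta >= 0 its only critical point below a is (a - 2
    beta) / 3, and R decreases on [c, a] under a mild condition, so that phat
    = c. When T - R changes sign exactly once, from positive to negative, the
    crossing is both the only stationary price and the maximizer
    ([modelfree_of_sign_change]).

    For the factor 1/2, take beta = 0 and let c tend to a = 1: valuations
    concentrate near 1, T - R is already negative at c, and its zero on the
    plateau, pstar = (1 + c) / 4, tends to 1/2 ([half_bound_tight]). For the
    factor phat / pstar, the objective has to be nearly constant between phat
    and pstar, which makes R nearly proportional to 1/p there. Take c = x1 and
    a = 3 x2 + 2 beta, which puts the critical point at x2 exactly, and let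
    beta grow: around the bounded interval [x1, x2] the cubic becomes flat.
    The revenue ratio is then at most (x1 / x2) (1 + x2 / beta)
    ([drop_revenue_ratio_le]), and 1 + x2 / beta <= (x2 / x1)^eps once beta is
    large ([power_bound_tight]). *)

(** * Prices under a CDF whose density lives on [0, a] *)

Section bounded_support.
Context {R : realType}.
Local Notation mu := (@lebesgue_measure R).
Variables (a : R) (F : cumulativeBounded (0 : R) (1 : R)) (f : R -> R).
Hypothesis a_ge0 : 0 <= a.
Hypothesis F_density : is_density F f.
Hypothesis f_support : supported_on 0 a f.

Lemma cdf_split (x y : R) : x <= y ->
  ((F y)%:E = (F x)%:E + \int[mu]_(t in `]x, y]) (f t)%:E)%E.
Proof.
move=> xy; have [mf f0 FE] := F_density.
rewrite !FE (@itv_bndbnd_setU _ _ _ (BRight x))//= ge0_integral_setU//=.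
- apply/measurable_EFinP; exact: measurable_funTS.
- by move=> t _; rewrite lee_fin.
- apply/disj_set2P; rewrite -subset0 => z/=; rewrite !in_itv/= => -[zx /andP[xz _]].
  by move: (lt_le_trans xz zx); rewrite ltxx.
Qed.

(** F stops growing after a, and its limit at +oo is 1. *)
Lemma cdf_ge_support (x : R) : a <= x -> F x = 1.
Proof.
have Fa y : a <= y -> F y = F a.
  move=> ay; apply: EFin_inj; rewrite (cdf_split ay) integral0_eq ?adde0//.
  move=> t /=; rewrite in_itv/= => /andP[at_ _]; congr EFin; apply: f_support.
  by rewrite in_itv/= negb_and -!ltNge at_ orbT.
move=> /Fa ->.
have h : F y @[y --> +oo] --> F a.
  apply: (@cvg_trans _ ((fun=> F a) y @[y --> +oo])); last exact: cvg_cst.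
  apply: near_eq_cvg; near=> y; apply/esym/Fa; near: y; exact: nbhs_pinfty_ge.
exact: (cvg_unique _ h (cumulativey F)).
Unshelve. all: by end_near. Qed.

Lemma cdf_nondecreasing (x y : R) : x <= y -> F x <= F y.
Proof. exact: cumulative_is_nondecreasing. Qed.

Lemma cdf_le1 (x : R) : F x <= 1.
Proof.
have [xa|/ltW/cdf_ge_support -> //] := leP x a.
by apply: (le_trans (cdf_nondecreasing xa)); rewrite cdf_ge_support.
Qed.

Lemma cdf0 : F 0 = 0.
Proof.
have [mf f0 FE] := F_density; apply: EFin_inj.
rewrite FE -integral_itv_bndo_bndc; last first.
  by apply/measurable_EFinP; exact: measurable_funTS.
apply: integral0_eq => t /=; rewrite in_itv/= => t0; congr EFin.
by apply: f_support; rewrite in_itv/= negb_and -!ltNge t0.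
Qed.

(** A CDF with a density has no atoms; on [0, a] it is the parameterized
    integral of the density. *)
Lemma cdf_within_continuous : {within `[0, a], continuous F}.
Proof.
have [mf f0 FE] := F_density.
have FE' x : 0 <= x -> (F x)%:E = (\int[mu]_(t in `[0%R, x]) (f t)%:E)%E.
  move=> x0; rewrite (cdf_split x0) cdf0 add0e integral_itv_obnd_cbnd//.
  by apply/measurable_EFinP; exact: measurable_funTS.
have intf : mu.-integrable `[0, a] (EFin \o f).
  apply/integrableP; split; first by apply/measurable_EFinP; exact: measurable_funTS.
  under eq_integral do rewrite /= ger0_norm//.
  by rewrite -FE'// ltry.
apply: (@subspace_eq_continuous _ _ _ (fun x => parameterized_integral mu 0 x f)).
  move=> x; rewrite inE/= in_itv/= => /andP[x0 _].
  by rewrite /parameterized_integral /Rintegral -FE'.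
exact: parameterized_integral_continuous.
Qed.

Lemma survival_within_continuous : {within `[0, a], continuous (fun x => 1 - F x)}.
Proof.
move=> x; apply: continuousB; [exact: cvg_cst|exact: cdf_within_continuous].
Qed.

Lemma survival_integrable (p q : R) : 0 <= p -> q <= a ->
  mu.-integrable `[p, q] (EFin \o (fun x => 1 - F x)).
Proof.
move=> p0 qa; apply: (@integrableS _ _ _ mu `[0, a]) => //.
  by apply: subset_itv; rewrite bnd_simp.
apply: continuous_compact_integrable; first exact: segment_compact.
exact: survival_within_continuous.
Qed.

Local Notation T := (tail_integral a F).

Lemma tail_integral_split (p q : R) : 0 <= p -> p <= q -> q <= a ->
  T p = \int[mu]_(x in `[p, q]) (1 - F x) + T q.
Proof.
move=> p0 pq qa; rewrite /tail_integral.
rewrite -(@Rintegral_itv_obnd_cbnd _ q); last first.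
  apply: integrableS (@survival_integrable q a _ _) => //.
    exact: subset_itv_oc_cc.
  exact: le_trans pq.
rewrite -(@Rintegral_itvB _ _ (BLeft p) (BRight a) q) ?bnd_simp//.
  by rewrite addrC subrK.
exact: survival_integrable.
Qed.

Lemma tail_integral_ge0 p : 0 <= T p.
Proof. by apply: Rintegral_ge0 => x _; rewrite subr_ge0 cdf_le1. Qed.

Lemma tail_integral_end : T a = 0.
Proof. by rewrite /tail_integral set_itv1 Rintegral_set1. Qed.

Lemma tail_integral_gt p : a < p -> T p = 0.
Proof.
by move=> ap; rewrite /tail_integral set_itv_ge ?Rintegral_set0// bnd_simp -ltNge.
Qed.

Lemma Rintegral_survival_ge (p q : R) : 0 <= p -> p <= q -> q <= a ->
  (q - p) * (1 - F q) <= \int[mu]_(x in `[p, q]) (1 - F x).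
Proof.
move=> p0 pq qa.
have -> : (q - p) * (1 - F q) = \int[mu]_(x in `[p, q]) (1 - F q).
  rewrite Rintegral_cst//= lebesgue_measure_itv/= lte_fin mulrC.
  by case: ltgtP pq => // -> _; rewrite subrr.
apply: le_Rintegral => //.
- apply: continuous_compact_integrable; first exact: segment_compact.
  by move=> x; exact: cvg_cst.
- exact: survival_integrable.
- by move=> x /=; rewrite in_itv/= => /andP[_ xq]; rewrite lerD2l lerN2 cdf_nondecreasing.
Qed.

Lemma tail_integralE p : 0 <= p <= a ->
  T p = T 0 - parameterized_integral mu 0 p (fun x => 1 - F x).
Proof.
move=> /andP[p0 pa]; rewrite (@tail_integral_split 0 p)//.
by rewrite /parameterized_integral addrC addKr.
Qed.

Lemma tail_integral_within_continuous : {within `[0, a], continuous T}.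
Proof.
apply: (@subspace_eq_continuous _ _ _
    (fun p => T 0 - parameterized_integral mu 0 p (fun x => 1 - F x))).
  move=> x; rewrite inE/= in_itv/= => h; exact/esym/tail_integralE.
move=> x; apply: (@cvgB _ R^o); first exact: cvg_cst.
apply: parameterized_integral_continuous => //.
exact: survival_integrable.
Qed.

Lemma is_derive_tail_integral (p : R) : 0 < p < a ->
  is_derive p (1 : R) T (- (1 - F p)).
Proof.
move=> /andP[p0 pa].
have cS : {for p, continuous (fun x => 1 - F x)}.
  have := survival_within_continuous.
  have a0 : 0 < a by exact: lt_trans pa.
  move=> /(continuous_within_itvP _ a0)[+ _ _]; apply.
  by rewrite in_itv/= p0.
have [dP P'] := @continuous_FTC1_closed _ (fun x => 1 - F x) 0 p a pa
  (survival_integrable (lexx _) (lexx _)) p0 cS.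
pose P y := parameterized_integral mu 0 y (fun x => 1 - F x).
have dP' : is_derive p (1 : R) P (1 - F p).
  by apply: DeriveDef => //; rewrite -derive1E.
have : is_derive p (1 : R) (fun y => T 0 - P y) (- (1 - F p)).
  rewrite -[X in is_derive _ _ _ X]sub0r; exact: is_deriveB.
apply: near_eq_is_derive.
near=> y; apply/esym; apply: tail_integralE; apply/andP; split; apply: ltW.
  by near: y; exact: lt_nbhsr.
by near: y; exact: lt_nbhsl.
Unshelve. all: by end_near. Qed.

(** Beyond a the factor 1 - F vanishes, and on [0, a] the uniform density is
    the constant 1/b. Past a both sides are 0, so that the formula covers every
    nonnegative price. *)
Lemma modelfree_objectiveE b p : 0 < b -> a <= b -> 0 <= p ->
  modelfree_objective (uniform_pdf 0 b) F p = b^-1 * (p * T p).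
Proof.
move=> b0 ab p0; rewrite /modelfree_objective /tail_integral mulrCA; congr (_ * _).
rewrite -RintegralZl//; last exact: survival_integrable.
rewrite Rintegral_mkcond [RHS]Rintegral_mkcond; congr (Rintegral _ _ _).
apply/funext => x; rewrite !patchE !mem_setE !in_itv/= andbT.
have [px|//] := leP p x; have [xa|ax] := leP x a => /=.
  by rewrite /uniform_pdf (le_trans p0 px) (le_trans xa ab) subr0.
by rewrite (cdf_ge_support (ltW ax)) subrr mulr0.
Qed.

(** Stationary prices are the critical points of the objective: the equation
    p (1 - F p) = T p says that this derivative is 0. *)
Lemma is_derive_price_times_tail (p : R) : 0 < p < a ->
  is_derive p (1 : R) (fun q => q * T q) (T p - revenue F p).
Proof.
move=> /is_derive_tail_integral dT.
have := @is_deriveM _ _ id T p (1 : R) 1 (- (1 - F p)) _ dT.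
rewrite /GRing.scale/= mulr1 addrC mulrN; apply.
Qed.

Lemma price_times_tail_within_continuous :
  {within `[0, a], continuous (fun p => p * T p)}.
Proof.
move=> x; apply: (@cvgM R).
  by apply: (@continuous_subspaceT _ _ `[0, a] id) => y; exact: cvg_id.
exact: tail_integral_within_continuous.
Qed.

(** The objective increases while T > R and decreases while T < R, so a single
    sign change of T - R locates its maximum as well as the stationary price. *)
Lemma modelfree_of_sign_change b pstar : a <= b -> 0 < pstar < a ->
  (forall p, 0 <= p < pstar -> revenue F p < T p) ->
  revenue F pstar = T pstar ->
  (forall p, pstar < p < a -> T p < revenue F p) ->
  stationary_prices a F = [set pstar] /\
  argmax `[0, +oo[ (modelfree_objective (uniform_pdf 0 b) F) pstar.
Proof.
move=> ab /andP[s0 sa] below eqs above.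
have a0 : 0 < a by exact: lt_trans sa.
have b0 : 0 < b by exact: lt_le_trans ab.
(* If T pstar were 0 then 1 - F would vanish from pstar on, contradicting
   T < R just after pstar. *)
have Ts : 0 < T pstar.
  rewrite lt_neqAle tail_integral_ge0 andbT eq_sym -eqs; apply/eqP => /eqP.
  rewrite mulf_eq0 gt_eqF//= => /eqP S0.
  have [m1 m2] := midf_lt sa.
  have := above _ (introT andP (conj m1 m2)); apply/negP; rewrite -leNgt.
  apply: le_trans (tail_integral_ge0 _); rewrite pmulr_rle0; last exact: lt_trans m1.
  have := cdf_nondecreasing (ltW m1); lra.
split.
  apply/seteqP; split=> [p [/= + E p_gt0]|_ ->]; last first.
    by split; [rewrite in_itv/= !ltW| |rewrite mulr_gt0].
  rewrite in_itv/= => /andP[p0 pa]; have [ps|sp|//] := ltgtP p pstar.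
    by have := below p; rewrite p0 ps /revenue E ltxx => /(_ isT).
  have := above p; rewrite sp /revenue E ltxx lt_neqAle pa andbT.
  case: eqVneq p_gt0 => [->|_ _ /(_ isT)//].
  by rewrite tail_integral_end mulr0 ltxx.
split => [|q] /=; rewrite in_itv/= andbT; first exact: ltW.
move=> q0; rewrite !modelfree_objectiveE// ?(ltW s0)// ler_wpM2l ?invr_ge0 ?(ltW b0)//.
have [aq|qa] := ltP a q; first by rewrite tail_integral_gt// mulr0 mulr_ge0 ?ltW.
have [qs|/ltW sq] := leP q pstar.
  apply: (@ger0_derive1_le_cc _ (fun p => p * T p) 0 pstar) => //;
    rewrite ?in_itv/= ?q0 ?lexx ?(ltW s0)//.
  - move=> x; rewrite in_itv/= => /andP[x0 xs].
    by have [] // := @is_derive_price_times_tail x; rewrite x0 (lt_trans xs).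
  - move=> x; rewrite in_itv/= => /andP[x0 xs].
    have [_] := @is_derive_price_times_tail x (introT andP (conj x0 (lt_trans xs sa))).
    by rewrite derive1E => ->; rewrite subr_ge0 ltW// below// ltW//.
  - apply: continuous_subspaceW price_times_tail_within_continuous.
    by apply: subset_itvl; rewrite bnd_simp ltW.
apply: (@ler0_derive1_le_cc _ (fun p => p * T p) pstar a) => //;
  rewrite ?in_itv/= ?sq ?qa ?lexx ?(ltW sa)//.
- move=> x; rewrite in_itv/= => /andP[sx xa].
  by have [] // := @is_derive_price_times_tail x; rewrite xa (lt_trans s0).
- move=> x; rewrite in_itv/= => /andP[sx xa].
  have [_] := @is_derive_price_times_tail x (introT andP (conj (lt_trans s0 sx) xa)).
  by rewrite derive1E => ->; rewrite subr_le0 ltW// above// sx.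
- apply: continuous_subspaceW price_times_tail_within_continuous.
  by apply: subset_itvr; rewrite bnd_simp ltW.
Qed.

Lemma revenue_within_continuous : {within `[0, a], continuous (revenue F)}.
Proof.
move=> x; apply: (@cvgM R).
  by apply: (@continuous_subspaceT _ _ `[0, a] id) => y; exact: cvg_id.
exact: survival_within_continuous.
Qed.

(** T - R is positive at price 0. If it were negative at some p < pstar, it
    would vanish at some q in ]0, p[ by continuity; as T q >= T pstar > 0, this
    q would be a stationary price other than pstar. *)
Lemma revenue_le_tail_below pstar p :
  stationary_prices a F = [set pstar] -> 0 < p < pstar -> revenue F p <= T p.
Proof.
move=> sE /andP[p0 ps]; rewrite leNgt; apply/negP => Tp.
have [] : stationary_prices a F pstar by rewrite sE.
rewrite in_itv/= => /andP[s0 sa] _ sT.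
have Ts : 0 < T pstar by rewrite -(pmulr_rgt0 _ (lt_trans p0 ps)).
have Tbefore q : 0 <= q -> q <= pstar -> 0 < T q.
  move=> q0 qs; rewrite (tail_integral_split q0 qs sa) ltr_wpDl//.
  by apply: Rintegral_ge0 => x _; rewrite subr_ge0 cdf_le1.
have [q q0p gq] : exists2 q, q \in `[0, p] & T q - revenue F q = 0.
  apply: IVT; first exact: ltW.
    move=> x; apply: (@cvgB _ R^o).
      apply: continuous_subspaceW tail_integral_within_continuous x.
      by apply: subset_itvl; rewrite bnd_simp (le_trans (ltW ps)).
    apply: continuous_subspaceW revenue_within_continuous x.
    by apply: subset_itvl; rewrite bnd_simp (le_trans (ltW ps)).
  rewrite ge_min le_max !subr_le0 !subr_ge0 (ltW Tp) orbT/=.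
  by rewrite /revenue mul0r tail_integral_ge0.
move: q0p; rewrite in_itv/= => /andP[q0 qp].
have qs : q < pstar by exact: le_lt_trans ps.
have Tq : 0 < T q by apply: Tbefore => //; exact: ltW.
have {}q0 : 0 < q.
  rewrite lt_neqAle q0 andbT; apply/eqP => q0'; move: gq Tq.
  by rewrite -q0' /revenue mul0r subr0 => ->; rewrite ltxx.
suff : stationary_prices a F q by rewrite sE => /= E; move: qs; rewrite E ltxx.
split; [|exact/esym/subr0_eq|exact: mulr_gt0].
by rewrite in_itv/= (ltW q0) (le_trans (ltW qs)).
Qed.

(** Two lower bounds on the revenue at pstar, through the survival probability
    at phat: directly, R pstar >= pstar (1 - F phat), and through stationarity,
    R pstar = T pstar >= (phat - pstar) (1 - F phat). Their sum is R phat. *)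
Lemma half_revenue_le pstar phat : stationary_prices a F pstar ->
  pstar <= phat <= a -> revenue F phat <= 2 * revenue F pstar.
Proof.
move=> [+ E _] /andP[sh ha]; rewrite in_itv/= => /andP[s0 _].
have RT : (phat - pstar) * (1 - F phat) <= T pstar.
  rewrite (tail_integral_split s0 sh ha).
  by rewrite (le_trans (Rintegral_survival_ge s0 sh ha))// lerDl tail_integral_ge0.
have RR : pstar * (1 - F phat) <= pstar * (1 - F pstar).
  by rewrite ler_wpM2l// lerD2l lerN2 cdf_nondecreasing.
rewrite /revenue; move: RT; rewrite -E; lra.
Qed.

(** When phat < pstar, the objective at pstar is pstar R pstar, and at phat it
    is at least phat R phat by the previous comparison of T with R. *)
Lemma revenue_ratio_lower_bound b pstar phat :
  a <= b ->
  argmax `[0, +oo[ (modelfree_objective (uniform_pdf 0 b) F) pstar ->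
  stationary_prices a F = [set pstar] ->
  argmax `[0, a] (revenue F) phat ->
  Num.min (phat / pstar) (1 / 2) <= revenue F pstar / revenue F phat.
Proof.
move=> ab [_ smax] sE [hI hmax].
have sS : stationary_prices a F pstar by rewrite sE.
have [sI E sT] := sS.
move: (sI) (hI); rewrite /= !in_itv/= => /andP[s0 sa] /andP[h0 ha].
have {}s0 : 0 < pstar.
  by rewrite lt_neqAle s0 andbT; apply/eqP => s0'; move: sT; rewrite -s0' mul0r ltxx.
have Ts : 0 < T pstar by rewrite -(pmulr_rgt0 _ s0).
have Rs : 0 < revenue F pstar by rewrite /revenue E.
have Rh : 0 < revenue F phat by exact: lt_le_trans (hmax _ sI).
have {}h0 : 0 < phat.
  rewrite lt_neqAle h0 andbT; apply/eqP => h0'; move: Rh.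
  by rewrite -h0' /revenue mul0r ltxx.
rewrite ge_min; have [sh|hs] := leP pstar phat.
  apply/orP; right; rewrite ler_pdivlMr//.
  have := half_revenue_le sS (introT andP (conj sh ha)); lra.
apply/orP; left; rewrite ler_pdivlMr// mulrAC ler_pdivrMr// [leRHS]mulrC.
have RT : revenue F phat <= T phat by apply: (revenue_le_tail_below sE); rewrite h0 hs.
have b0 : 0 < b by exact: lt_le_trans (lt_le_trans s0 sa) ab.
have := smax phat; rewrite /= in_itv/= (ltW h0) => /(_ isT).
rewrite !modelfree_objectiveE// ?(ltW s0) ?(ltW h0)// ler_pM2l ?invr_gt0// -E => le1.
by apply: le_trans le1; rewrite ler_wpM2l// ltW.
Qed.

End bounded_support.

(** * Constructing a CDF from a smooth profile *)

Section antiderivatives.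
Context {R : realType}.
Local Notation mu := (@lebesgue_measure R).

Lemma is_derive_continuous (H : R -> R) (x h : R) :
  is_derive x (1 : R) H h -> {for x, continuous H}.
Proof. by move=> [dH _]; apply/differentiable_continuous/derivable1_diffP. Qed.

Lemma is_derive_invr (x : R) : x != 0 ->
  is_derive x (1 : R) (fun y : R => y^-1) (- x ^- 2).
Proof.
move=> x0; have := @is_deriveV R id x 1 1 x0 _.
by rewrite /GRing.scale/= mulr1; apply; exact: is_derive_id.
Qed.

Lemma integral_antiderivative (h H : R -> R) (p q : R) : p <= q ->
  {within `[p, q], continuous h} ->
  (forall x, p <= x <= q -> is_derive x (1 : R) H (h x)) ->
  (\int[mu]_(x in `[p, q]) (h x)%:E = (H q - H p)%:E)%E.
Proof.
rewrite le_eqVlt => /predU1P[->|pq] ch dH.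
  by rewrite set_itv1 integral_set1 subrr.
have cH x : p <= x <= q -> {for x, continuous H}.
  by move=> /dH; exact: is_derive_continuous.
rewrite (@continuous_FTC2 _ h H p q)//.
- split.
  + move=> x; rewrite in_itv/= => /andP[px xq].
    by have [] : is_derive x (1 : R) H (h x) by apply: dH; rewrite !ltW.
  + by apply: cvg_at_right_filter; apply: cH; rewrite lexx ltW.
  + by apply: cvg_at_left_filter; apply: cH; rewrite lexx ltW.
- move=> x; rewrite in_itv/= => /andP[px xq]; rewrite derive1E.
  by have [] : is_derive x (1 : R) H (h x) by apply: dH; rewrite !ltW.
Qed.

(** The way to produce CDFs with explicit density: clamping the argument to
    [c, a] extends H to the whole line, as 0 before c and 1 after a, with no
    case distinction, so continuity and monotonicity come by composition. *)
Lemma antiderivative_cdf (c a : R) (h H : R -> R) : c < a ->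
  {within `[c, a], continuous h} -> (forall x, c <= x <= a -> 0 <= h x) ->
  (forall x, c <= x <= a -> is_derive x (1 : R) H (h x)) -> H c = 0 -> H a = 1 ->
  exists F : cumulativeBounded (0 : R) (1 : R),
    (forall x, F x = H (Num.max c (Num.min x a))) /\ is_density F (h \_ `[c, a]).
Proof.
move=> ca ch h0 dH Hc Ha.
pose k (x : R) := Num.max c (Num.min x a).
have kI x : c <= k x <= a by rewrite /k le_max lexx ge_max (ltW ca) ge_min lexx orbT.
have kmono x y : x <= y -> k x <= k y.
  by move=> xy; rewrite /k le_max2// le_min2.
have ck x : {for x, continuous k}.
  apply: (@continuous_max _ _ (cst c) (fun x => Num.min x a)); first exact: cvg_cst.
  by apply: (@continuous_min _ _ id (cst a)); [exact: cvg_id|exact: cvg_cst].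
have cH x : c <= x <= a -> {for x, continuous H}.
  by move=> /dH; exact: is_derive_continuous.
have cHk x : {for x, continuous (H \o k)}.
  by apply: continuous_comp; [exact: ck|exact: cH].
have Hmono x y : c <= x <= a -> c <= y <= a -> x <= y -> H x <= H y.
  move=> xI yI xy; apply: (@ger0_derive1_le_cc _ H c a); rewrite ?in_itv//=.
  - move=> z; rewrite in_itv/= => /andP[/ltW cz /ltW za].
    by have [] := dH z (introT andP (conj cz za)).
  - move=> z; rewrite in_itv/= => /andP[/ltW cz /ltW za]; rewrite derive1E.
    by have [_ ->] := dH z (introT andP (conj cz za)); rewrite h0// cz.
  - apply: derivable_within_continuous => z; rewrite in_itv/= => /dH.
    by case.
have HkNy : (H \o k) x @[x --> -oo] --> (0 : R).
  apply: (@cvg_trans _ ((fun=> 0 : R) y @[y --> -oo])); last exact: cvg_cst.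
  apply: near_eq_cvg; near=> y; rewrite /= /k (_ : Num.max _ _ = c) ?Hc//.
  apply/max_l; rewrite ge_min; apply/orP; left.
  by near: y; apply: nbhs_ninfty_le; exact: num_real.
have Hky : (H \o k) x @[x --> +oo] --> (1 : R).
  apply: (@cvg_trans _ ((fun=> 1 : R) y @[y --> +oo])); last exact: cvg_cst.
  apply: near_eq_cvg; near=> y; rewrite /= /k (_ : Num.min _ _ = a) ?max_r ?(ltW ca)//.
  by apply/min_r; near: y; apply: nbhs_pinfty_ge; exact: num_real.
have Hknd : nondecreasing (H \o k) by move=> x y xy; apply: Hmono => //; exact: kmono.
have Hkrc : right_continuous (H \o k) by apply: right_continuousW => x; exact: cHk.
pose F : cumulativeBounded (0 : R) (1 : R) := HB.pack (H \o k)
  (isCumulative.Build R _ R (H \o k) Hknd Hkrc)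
  (isCumulativeBounded.Build R 0 1 (H \o k) HkNy Hky).
exists F; split => //; split.
- have [+ _] := measurable_restrictT h (measurable_itv `[c, a]); apply.
  exact: (subspace_continuous_measurable_fun (measurable_itv _) ch).
- by move=> x; rewrite patchE; case: ifPn => //; rewrite inE/= in_itv/=; exact: h0.
- move=> x; rewrite (_ : (fun t => _) = (EFin \o h) \_ `[c, a]) -?integral_mkcondr;
    last first.
    by rewrite restrict_EFin.
  have -> : `]-oo, x] `&` `[c, a] = `[c, Num.min x a]%classic.
    apply/seteqP; split => y /=; rewrite !in_itv/= le_min.
      by move=> [-> /andP[-> ->]].
    by move=> /and3P[-> -> ->].
  rewrite /F/= /k; have [cm|mc] := leP c (Num.min x a).
    have ma : Num.min x a <= a by rewrite ge_min lexx orbT.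
    have cm' : {within `[c, Num.min x a], continuous h}.
      by apply: continuous_subspaceW ch; apply: subset_itvl; rewrite bnd_simp.
    have dm y : c <= y <= Num.min x a -> is_derive y (1 : R) H (h y).
      by move=> /andP[cy ym]; apply: dH; rewrite cy (le_trans ym).
    by rewrite (integral_antiderivative cm cm' dm) Hc subr0.
  by rewrite set_itv_ge ?integral_set0 ?Hc// bnd_simp -ltNge.
Unshelve. all: by end_near. Qed.

End antiderivatives.

(** Both conditions on the revenue curve, unimodality and uniqueness of the
    maximizer, follow from strict monotonicity on either side of c. *)
Lemma strict_peak (R : realType) (a c : R) (h : R -> R) : 0 <= c <= a ->
  {in `[0, c] &, {homo h : x y / x < y}} ->
  {in `[c, a] &, {homo h : x y /~ x < y}} ->
  unimodal_on 0 a h /\ argmax `[0, a] h = [set c].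
Proof.
move=> /andP[c0 ca] inc dec.
have cI : c \in `[0, c] by rewrite in_itv/= c0 lexx.
have cJ : c \in `[c, a] by rewrite in_itv/= ca lexx.
have lth q : 0 <= q <= a -> q != c -> h q < h c.
  move=> /andP[q0 qa]; rewrite neq_lt => /orP[qc|cq].
    by apply: inc => //; rewrite in_itv/= q0 ltW.
  by apply: dec => //; rewrite in_itv/= qa ltW.
have cmax : argmax `[0, a] h c.
  split=> [|q] /=; rewrite in_itv/= ?c0// => qI.
  by have [->//|/(lth _ qI)/ltW] := eqVneq q c.
split.
  exists c; split => // x y xI yI; rewrite le_eqVlt => /predU1P[->//|xy]; apply: ltW.
    exact: inc.
  exact: dec.
apply/seteqP; split=> [q [qI qmax]|_ ->] //; move: qI; rewrite /= in_itv/= => qI.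
apply/eqP/negPn/negP => /(lth _ qI); apply/negP; rewrite -leNgt.
by apply: qmax; rewrite /= in_itv/= c0.
Qed.

(** * A plateau followed by a drop *)

Section plateau_then_drop.
Context {R : realType}.
Local Notation mu := (@lebesgue_measure R).
Variables c a beta : R.

(** The survival function on [c, a], up to the factor 1 / drop_profile c that
    makes it start at 1. It is minus the derivative of [drop_tail], which in
    turn is the cubic (a - p)^2 (p + beta) divided by p, so that the objective
    p T(p) is a multiple of this cubic. *)
Definition drop_profile (p : R) : R :=
  2 * a - beta - 2 * p + a ^+ 2 * beta * p^-1 ^+ 2.

Definition drop_tail (p : R) : R := (a - p) ^+ 2 * (1 + beta * p^-1).

Local Notation w := drop_profile.
Local Notation U := drop_tail.

Hypothesis c_gt0 : 0 < c.
Hypothesis c_lt_a : c < a.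
Hypothesis beta_ge0 : 0 <= beta.

Lemma drop_profileE p : p != 0 ->
  w p = (a - p) * (2 + beta / p + a * beta / p ^+ 2).
Proof. by move=> p0; rewrite /w; field. Qed.

Lemma drop_profile_gt0 : 0 < w c.
Proof.
rewrite drop_profileE ?gt_eqF// mulr_gt0 ?subr_gt0//.
have a0 : 0 <= a by rewrite ltW// (lt_trans c_gt0).
have : 0 <= beta / c by rewrite divr_ge0// ltW.
have : 0 <= a * beta / c ^+ 2 by rewrite divr_ge0 ?mulr_ge0// ltW.
lra.
Qed.

Lemma drop_profile_end : w a = 0.
Proof.
rewrite drop_profileE ?subrr ?mul0r//.
by rewrite gt_eqF// (lt_trans c_gt0).
Qed.

(** T - R on [c, a] up to a positive factor, that is, the derivative of the
    cubic (a - p)^2 (p + beta). *)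
Lemma drop_marginal p : p != 0 ->
  U p - p * w p = (a - p) * (a - 2 * beta - 3 * p).
Proof. by move=> p0; rewrite /w /U; field. Qed.

Lemma is_derive_drop_profile (x : R) : x != 0 ->
  is_derive x (1 : R) w (- (2 + 2 * a ^+ 2 * beta * x^-1 ^+ 3)).
Proof.
move=> x0; have dV := is_derive_invr x0.
have -> : w = cst (2 * a - beta) - 2 \*: id +
    (a ^+ 2 * beta) \*: ((fun y : R => y^-1) ^+ 2).
  by apply/funext => y; rewrite /w; reflexivity.
apply: is_derive_eq; rewrite /GRing.scale/= expr1.
by field.
Qed.

Lemma is_derive_drop_tail (x : R) : x != 0 -> is_derive x (1 : R) U (- w x).
Proof.
move=> x0; have dV := is_derive_invr x0.
have -> : U = (cst a - id) ^+ 2 * (cst 1 + beta \*: (fun y : R => y^-1)).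
  by apply/funext => y; reflexivity.
apply: is_derive_eq; rewrite !fctE /GRing.scale/= expr1 /w -[beta *: _]/(beta * _).
by field.
Qed.

Lemma drop_cdf_exists : exists (F : cumulativeBounded (0 : R) (1 : R)) (f : R -> R),
  [/\ is_density F f, supported_on 0 a f, (forall x, x <= c -> F x = 0) &
      forall x, c <= x <= a -> 1 - F x = w x / w c].
Proof.
have wc := drop_profile_gt0.
have xn0 x : c <= x <= a -> x != 0.
  by move=> /andP[cx _]; rewrite gt_eqF// (lt_le_trans c_gt0).
pose h x := (w c)^-1 * (2 + 2 * a ^+ 2 * beta * x^-1 ^+ 3).
have ch : {within `[c, a], continuous h}.
  apply: derivable_within_continuous => x; rewrite in_itv/= => /xn0 x0.
  have dV := is_derive_invr x0.
  have -> : h = (w c)^-1 \*: (cst 2 + (2 * a ^+ 2 * beta) \*: ((fun y : R => y^-1) ^+ 3)).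
    by apply/funext => y; reflexivity.
  exact: ex_derive.
have h0 x : c <= x <= a -> 0 <= h x.
  move=> /andP[cx xa]; rewrite mulr_ge0 ?invr_ge0 ?(ltW wc)// addr_ge0//.
  apply: mulr_ge0; last by rewrite exprn_ge0// invr_ge0 (le_trans (ltW c_gt0)).
  by apply: mulr_ge0 => //; apply: mulr_ge0 => //; exact: sqr_ge0.
pose H := cst 1 - (w c)^-1 \*: w.
have HE x : H x = 1 - (w c)^-1 * w x by [].
have dH x : c <= x <= a -> is_derive x (1 : R) H (h x).
  move=> /xn0/is_derive_drop_profile dw; apply: is_derive_eq.
  by rewrite /h /GRing.scale/= sub0r mulrN opprK.
have Hc : H c = 0 by rewrite HE mulVf ?subrr// gt_eqF.
have Ha : H a = 1 by rewrite HE drop_profile_end mulr0 subr0.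
have [F [FE Fd]] := antiderivative_cdf c_lt_a ch h0 dH Hc Ha.
exists F, (h \_ `[c, a]); split=> // x.
- move=> xI; rewrite patchE ifF//; apply/negbTE; apply: contra xI.
  by rewrite inE/= !in_itv/= => /andP[cx ->]; rewrite (le_trans (ltW c_gt0)).
- by move=> xc; rewrite FE max_l ?Hc// ge_min xc.
- move=> /andP[cx xa]; rewrite FE min_l// max_r// HE.
  by rewrite opprB addrC subrK mulrC.
Qed.

Variables (F : cumulativeBounded (0 : R) (1 : R)) (f : R -> R).
Hypothesis F_density : is_density F f.
Hypothesis f_support : supported_on 0 a f.
Hypothesis F_plateau : forall x, x <= c -> F x = 0.
Hypothesis F_drop : forall x, c <= x <= a -> 1 - F x = w x / w c.

Local Notation T := (tail_integral a F).

Let a_gt0 : 0 < a. Proof. exact: lt_trans c_lt_a. Qed.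
Let a_ge0 : 0 <= a. Proof. exact: ltW. Qed.
Let wc_gt0 : 0 < w c := drop_profile_gt0.

Lemma Rintegral_survival_antiderivative (V : R -> R) (p q : R) :
  0 <= p -> p <= q -> q <= a ->
  (forall x, p <= x <= q -> is_derive x (1 : R) V (1 - F x)) ->
  \int[mu]_(x in `[p, q]) (1 - F x) = V q - V p.
Proof.
move=> p0 pq qa dV; rewrite /Rintegral.
have cS : {within `[p, q], continuous (fun x => 1 - F x)}.
  apply: continuous_subspaceW (survival_within_continuous a_ge0 F_density f_support).
  by apply: subset_itv; rewrite bnd_simp.
by rewrite (integral_antiderivative pq cS dV).
Qed.

Lemma drop_tail_integral p : c <= p <= a -> T p = U p / w c.
Proof.
move=> /andP[cp pa].
have dV x : p <= x <= a -> is_derive x (1 : R) (- (w c)^-1 \*: U) (1 - F x).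
  move=> /andP[px xa]; have cx := le_trans cp px.
  have x0 : x != 0 by rewrite gt_eqF// (lt_le_trans c_gt0).
  have dU := is_derive_drop_tail x0; apply: is_derive_eq.
  by rewrite /GRing.scale/= mulrNN F_drop ?cx// mulrC.
rewrite /tail_integral.
rewrite (Rintegral_survival_antiderivative (le_trans (ltW c_gt0) cp) pa (lexx a) dV).
rewrite -[LHS]/(- (w c)^-1 * U a - - (w c)^-1 * U p) {1}/U subrr.
by rewrite expr0n/= mul0r mulr0 sub0r mulNr opprK mulrC.
Qed.

Lemma plateau_tail_integral p : 0 <= p <= c -> T p = c - p + U c / w c.
Proof.
move=> /andP[p0 pc].
rewrite (tail_integral_split a_ge0 F_density f_support p0 pc (ltW c_lt_a)).
rewrite drop_tail_integral ?lexx ?ltW//; congr (_ + _).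
apply: (@Rintegral_survival_antiderivative id) => //; first exact: ltW.
by move=> x /andP[_ xc]; rewrite F_plateau// subr0; exact: is_derive_id.
Qed.

Lemma plateau_revenue p : p <= c -> revenue F p = p.
Proof. by move=> pc; rewrite /revenue F_plateau// subr0 mulr1. Qed.

Lemma drop_revenue p : c <= p <= a -> revenue F p = p * w p / w c.
Proof. by move=> pI; rewrite /revenue F_drop// mulrA. Qed.

(** R is a positive multiple of (2a - beta) p - 2 p^2 + a^2 beta / p. Its
    difference quotient over [x, y] is negative as soon as
    2a < beta + 2(x + y) + a^2 beta / (x y). If a <= 2c this is clear from
    x + y > 2c. Otherwise either x + y >= a, or 4 x y <= a^2 and the last term
    alone brings 4 beta. *)
Lemma drop_revenue_decreasing : a <= 2 * c \/ 2 * a <= 5 * beta ->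
  {in `[c, a] &, {homo revenue F : x y /~ x < y}}.
Proof.
move=> steep y x; rewrite !in_itv/= => yI xI xy.
rewrite !drop_revenue// ltr_pM2r ?invr_gt0//.
move: yI xI => /andP[cy ya] /andP[cx xa].
have x0 : 0 < x by exact: lt_le_trans cx.
have y0 : 0 < y by exact: lt_le_trans cy.
have xn0 : x != 0 by rewrite gt_eqF.
have yn0 : y != 0 by rewrite gt_eqF.
rewrite -subr_gt0.
have -> : x * w x - y * w y =
    (y - x) * (beta + 2 * (x + y) + beta * (a ^+ 2 / (x * y)) - 2 * a).
  by rewrite /w; field; rewrite xn0 yn0.
rewrite mulr_gt0 ?subr_gt0//.
have q0 : 0 <= a ^+ 2 / (x * y) by rewrite divr_ge0 ?sqr_ge0// mulr_ge0// ltW.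
have b_ge0 := beta_ge0; case: steep => [ac|ab].
  by have := mulr_ge0 beta_ge0 q0; move: (beta * _) => bq bq0; lra.
have [axy|xya] := leP a (x + y).
  by have := mulr_ge0 beta_ge0 q0; move: (beta * _) => bq bq0; lra.
have : 4 <= a ^+ 2 / (x * y).
  rewrite ler_pdivlMr ?mulr_gt0//.
  have -> : a ^+ 2 = 4 * (x * y) + ((x - y) ^+ 2 + (a - (x + y)) * (a + (x + y))).
    by ring.
  by rewrite lerDl addr_ge0 ?sqr_ge0// mulr_ge0 ?subr_ge0 ?ltW// !addr_gt0.
by move=> /(ler_wpM2l beta_ge0); move: (beta * (_ / _)) => bq bq4; lra.
Qed.

Lemma drop_instance pstar : a <= 2 * c \/ 2 * a <= 5 * beta ->
  0 < pstar < a ->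
  (forall p, 0 <= p < pstar -> revenue F p < T p) ->
  revenue F pstar = T pstar ->
  (forall p, pstar < p < a -> T p < revenue F p) ->
  pricing_instance a a F f pstar c.
Proof.
move=> steep sI below eqs above.
have [sE smax] := modelfree_of_sign_change a_ge0 F_density f_support (lexx a)
  sI below eqs above.
have [uni cE] : unimodal_on 0 a (revenue F) /\ argmax `[0, a] (revenue F) = [set c].
  apply: strict_peak; first by rewrite !ltW.
    move=> x y; rewrite !in_itv/= => /andP[_ xc] /andP[_ yc] xy.
    by rewrite !plateau_revenue.
  exact: drop_revenue_decreasing.
split; last by split.
split => //; first by rewrite a_ge0/=.
by split => // x x0; apply: F_plateau; rewrite ltW// (lt_trans x0).
Qed.

(** Here T - R is already negative at c, hence its zero pstar lies on the
    plateau, where T - R is affine with slope -2. *)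
Lemma peak_on_plateau_instance (pstar := (c + U c / w c) / 2) :
  a <= 2 * c \/ 2 * a <= 5 * beta -> a - 2 * beta < 3 * c ->
  pricing_instance a a F f pstar c /\ revenue F pstar = pstar.
Proof.
move=> steep ac.
have [b0 c0] := (beta_ge0, c_gt0); have Uc0 : 0 <= U c / w c.
  rewrite divr_ge0 ?(ltW wc_gt0)// mulr_ge0 ?sqr_ge0// addr_ge0// divr_ge0// ltW//.
have Uc : U c / w c < c.
  rewrite ltr_pdivrMr// -subr_lt0 drop_marginal ?gt_eqF//.
  by rewrite nmulr_llt0 ?subr_gt0//; lra.
have sc : pstar < c by rewrite /pstar; lra.
have s0 : 0 < pstar by rewrite /pstar; lra.
split; last by rewrite plateau_revenue// ltW.
apply: drop_instance => //; first by rewrite s0 (lt_trans sc).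
- move=> p /andP[p0 ps]; have pc := ltW (lt_trans ps sc).
  rewrite plateau_revenue// plateau_tail_integral ?p0//.
  by move: ps; rewrite /pstar; lra.
- rewrite plateau_revenue ?plateau_tail_integral ?(ltW sc) ?(ltW s0)//.
  by rewrite /pstar; field; rewrite gt_eqF.
- move=> p /andP[sp pa]; have [pc|cp] := leP p c.
    rewrite plateau_revenue// plateau_tail_integral ?pc ?andbT;
      last exact: ltW (lt_trans s0 sp).
    by move: sp; rewrite /pstar; lra.
  have pI : c <= p <= a by rewrite !ltW.
  rewrite drop_revenue// drop_tail_integral// ltr_pM2r ?invr_gt0//.
  rewrite -subr_lt0 drop_marginal ?gt_eqF ?(lt_trans c_gt0)//.
  by rewrite nmulr_llt0 ?subr_gt0//; lra.
Qed.

(** Here the critical point pstar = (a - 2 beta) / 3 of the cubic lies beyond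
    c. Then T - R is positive at c, hence on the whole plateau, where it is
    decreasing. *)
Lemma peak_on_drop_instance pstar :
  2 * a <= 5 * beta -> a = 3 * pstar + 2 * beta -> c < pstar ->
  pricing_instance a a F f pstar c.
Proof.
move=> ab aE cs.
have [b0 s0] := (beta_ge0, lt_trans c_gt0 cs).
have marginal p : c <= p <= a -> T p - revenue F p = (a - p) * (pstar - p) * (3 / w c).
  move=> pI; rewrite drop_revenue// drop_tail_integral// -mulrBl drop_marginal.
    by rewrite aE; field; rewrite gt_eqF.
  by case/andP: pI => cp _; rewrite gt_eqF// (lt_le_trans c_gt0).
have k0 : 0 < 3 / w c by rewrite divr_gt0.
have sa : pstar < a by lra.
apply: drop_instance; [by right|by rewrite s0| | |].
- move=> p /andP[p0 ps]; rewrite -subr_gt0.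
  have [cp|pc] := leP c p.
    by rewrite marginal ?cp ?(ltW (lt_trans ps sa))// pmulr_lgt0//
      mulr_gt0 ?subr_gt0// (lt_trans ps).
  rewrite plateau_revenue ?plateau_tail_integral ?p0 ?ltW//.
  have : 0 < T c - revenue F c.
    by rewrite marginal ?lexx ?ltW// pmulr_lgt0// mulr_gt0 ?subr_gt0.
  rewrite plateau_revenue// plateau_tail_integral ?lexx ?ltW//; lra.
- by apply/esym/subr0_eq; rewrite marginal ?subrr ?mulr0 ?mul0r// !ltW.
- move=> p /andP[sp pa]; rewrite -subr_lt0 marginal ?ltW// ?(lt_trans cs)//.
  by rewrite pmulr_llt0// pmulr_rlt0 ?subr_gt0// subr_lt0.
Qed.

(** With w the unnormalized survival function, q^2 w(q) is
    (a - q) (2 q^2 + beta q + a beta), in which a beta is the dominant term: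
    dropping the others at c, and bounding them at p by a p thanks to
    2 p + beta <= 2 beta <= a, leaves the factor 1 + p / beta. *)
Lemma drop_revenue_ratio_le p : c < p < a -> 2 * p <= beta -> 2 * beta <= a ->
  revenue F p / revenue F c <= c / p * (1 + p / beta).
Proof.
move=> /andP[cp pa] pb ba; have [c0 p0] := (c_gt0, lt_trans c_gt0 cp).
have b0 : 0 < beta by lra.
rewrite (plateau_revenue (lexx c)) drop_revenue; last by rewrite !ltW.
have sq q : q != 0 -> q ^+ 2 * w q = (a - q) * (2 * q ^+ 2 + beta * q + a * beta).
  by move=> q0; rewrite /w; field.
have lower : (a - p) * (a * beta) <= c ^+ 2 * w c.
  rewrite sq ?gt_eqF// ler_pM ?subr_ge0 ?(ltW pa) ?lerD2l ?lerN2 ?(ltW cp)//.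
    by rewrite mulr_ge0 ?ltW.
  by rewrite lerDr addr_ge0// mulr_ge0 ?sqr_ge0// ltW.
have key : p ^+ 2 * w p <= c ^+ 2 * w c * (1 + p / beta).
  apply: le_trans (ler_wpM2r _ lower); last by rewrite addr_ge0// divr_ge0// ltW.
  rewrite sq ?gt_eqF// -mulrA ler_wpM2l ?subr_ge0 ?(ltW pa)//.
  have -> : a * beta * (1 + p / beta) = p * a + a * beta by field; rewrite gt_eqF.
  rewrite lerD2r; have -> : 2 * p ^+ 2 + beta * p = p * (2 * p + beta) by ring.
  by rewrite ler_pM2l//; lra.
rewrite ler_pdivrMr// ler_pdivrMr//.
have -> : c / p * (1 + p / beta) * c * w c = c ^+ 2 * w c * (1 + p / beta) / p by ring.
by rewrite ler_pdivlMr// mulrC mulrA -expr2.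
Qed.

End plateau_then_drop.

(** * Tightness and the theorem *)

(** Uniform valuations on [c, 1] with c close to 1. *)
Lemma half_bound_tight (R : realType) (eps : R) : 0 < eps ->
  exists (a b : R) (F : cumulativeBounded (0 : R) (1 : R)) (f : R -> R)
    (pstar phat : R),
    pricing_instance a b F f pstar phat /\
    revenue F pstar / revenue F phat <= 1 / 2 + eps.
Proof.
(* Any c in [1/2, 1[ with c (1 + 4 eps) >= 1 works: the ratio is
   (1 + c) / (4 c). *)
move=> e0; pose c : R := (1 + 2 * eps) / (1 + 4 * eps).
have d0 : 0 < 1 + 4 * eps by lra.
have cE : c * (1 + 4 * eps) = 1 + 2 * eps by rewrite /c divfK ?gt_eqF.
have c0 : 0 < c by rewrite /c divr_gt0//; lra.
have c1 : c < 1 by rewrite /c ltr_pdivrMr//; lra.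
have c2 : 1 <= 2 * c by rewrite -(ler_pM2r d0) -mulrA cE; lra.
have [F [f [dF sf Fp Fd]]] := drop_cdf_exists c0 c1 (lexx 0).
have steep : 1 <= 2 * c \/ 2 * 1 <= 5 * 0 :> R by left.
have c3 : 1 - 2 * 0 < 3 * c by lra.
have pE : (c + drop_tail 1 0 c / drop_profile 1 0 c) / 2 = (1 + c) / 4.
  by rewrite /drop_tail /drop_profile; field; rewrite !gt_eqF; lra.
have := peak_on_plateau_instance c0 c1 (lexx 0) dF sf Fp Fd steep c3.
rewrite pE => -[inst Rs]; exists 1, 1, F, f, ((1 + c) / 4), c; split=> //.
rewrite Rs (plateau_revenue Fp (lexx c)) ler_pdivrMr//.
lra.
Qed.

(** The slack (x2 / x1)^eps > 1 between the exponents 1 and 1 - eps absorbs the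
    error factor 1 + x2 / beta. *)
Lemma power_bound_tight (R : realType) (x1 x2 eps : R) : 0 < x1 -> x1 < x2 -> 0 < eps ->
  exists (a b : R) (F : cumulativeBounded (0 : R) (1 : R)) (f : R -> R),
    pricing_instance a b F f x2 x1 /\
    revenue F x2 / revenue F x1 <= x1 `^ (1 - eps) / x2 `^ (1 - eps).
Proof.
move=> x10 x12 e0; have x20 := lt_trans x10 x12.
pose d : R := (x2 / x1) `^ eps - 1.
have d0 : 0 < d.
  have : 1 `^ eps < (x2 / x1) `^ eps.
    apply: gt0_ltr_powR; rewrite // ?nnegrE ?divr_ge0 ?(ltW x10) ?(ltW x20)//.
    by rewrite ltr_pdivlMr ?mul1r.
  by rewrite powR1 -subr_gt0.
(* The first summand gives 2 a <= 5 beta, the second x2 / beta <= d. *)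
pose beta := 6 * x2 + x2 / d; pose a := 3 * x2 + 2 * beta.
have b6 : 6 * x2 <= beta by rewrite /beta lerDl divr_ge0// ltW.
have b0 : 0 < beta by lra.
have xa : x2 < a by rewrite /a; lra.
have x1a := lt_trans x12 xa.
have [F [f [dF sf Fp Fd]]] := drop_cdf_exists x10 x1a (ltW b0).
exists a, a, F, f; split.
  by apply: (peak_on_drop_instance x10 x1a (ltW b0) dF sf Fp Fd) => //; rewrite /a; lra.
apply: le_trans (drop_revenue_ratio_le x10 x1a (ltW b0) Fp Fd _ _ _) _.
- by rewrite x12.
- by lra.
- by rewrite /a; lra.
have bd : x2 / beta <= d.
  rewrite ler_pdivrMr// /beta mulrDr [d * (x2 / d)]mulrC divfK ?gt_eqF//.
  by rewrite lerDr mulr_ge0 ?mulr_ge0// ltW.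
have le1 : 1 + x2 / beta <= (x2 / x1) `^ eps by rewrite -lerBrDl.
apply: le_trans (ler_wpM2l _ le1) _; first by rewrite divr_ge0 ?ltW.
have xn1 : x1 `^ eps != 0 by rewrite gt_eqF// powR_gt0.
have xn2 : x2 `^ eps != 0 by rewrite gt_eqF// powR_gt0.
have pE (x : R) : 0 < x -> x `^ (1 - eps) = x / x `^ eps.
  by move=> x0; rewrite powRB ?powRr1 ?(ltW x0)//; apply/implyP => _; rewrite gt_eqF.
have x2E : x2 `^ eps = (x2 / x1) `^ eps * x1 `^ eps.
  by rewrite -powRM ?divr_ge0 ?ltW// divfK ?gt_eqF.
rewrite !pE// x2E.
have qn : (x2 / x1) `^ eps != 0 by rewrite gt_eqF// powR_gt0// divr_gt0.
rewrite le_eqVlt; apply/orP; left; apply/eqP; field.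
by rewrite xn1 qn !gt_eqF.
Qed.

Unset Implicit Arguments.

Theorem theorem1 (R : realType) :
  (forall (a b : R) (F : cumulativeBounded (0 : R) (1 : R)) (f : R -> R)
      (pstar phat : R),
    pricing_instance a b F f pstar phat ->
    Num.min (phat / pstar) (1 / 2) <= revenue F pstar / revenue F phat)
  /\
  (forall eps : R, 0 < eps ->
    exists (a b : R) (F : cumulativeBounded (0 : R) (1 : R)) (f : R -> R)
      (pstar phat : R),
      pricing_instance a b F f pstar phat /\
      revenue F pstar / revenue F phat <= 1 / 2 + eps)
  /\
  (forall x1 x2 eps : R,
    0 < x1 -> x1 < x2 -> x2 < 1 / expR 1 -> 0 < eps ->
    exists (a b : R) (F : cumulativeBounded (0 : R) (1 : R)) (f : R -> R)
      (pstar phat : R),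
      [/\ pricing_instance a b F f pstar phat,
          phat = x1,
          `|pstar - x2| < eps &
          revenue F pstar / revenue F phat
            <= phat `^ (1 - eps) / pstar `^ (1 - eps)]).
Proof.
split=> [a b F f pstar phat|]; last split=> [|x1 x2 eps x10 x12 _ e0].
- move=> [[/andP[a0 ab] [_ dF] sf smax] [sE _ hE]].
  by apply: (revenue_ratio_lower_bound a0 dF sf ab smax sE); rewrite hE.
- exact: half_bound_tight.
- have [a [b [F [f [inst le_ratio]]]]] := power_bound_tight x10 x12 e0.
  by exists a, b, F, f, x2, x1; split=> //; rewrite subrr normr0.
Qed.
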